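(* Let $I\subset\mathbb{R}$ be an open interval containing $0$, let $g:I\to\mathbb{H}^2$ be a unit speed space-like curve with $\kappa_g^2(v)>1$ for all $v\in I$, let $a\neq0$, $\theta\ne0$, $u>0$ be real constants, $\xi_2=\coth\theta\,\ln u$, and let $$\tilde\gamma(v)=a\int_0^v g(t)\,dt+a\tanh\xi_2\int_0^v g(t)\times g'(t)\,dt$$ be a time-like Bertrand curve (the time-like Bertrand curve corresponding to $g$). Then the hyperbolic Darboux image of $\tilde\gamma$ is equal to the hyperbolic evolute of $g$; that is, $C(v)=h_g(v)$ for all $v\in I$.
   Context: Minkowski 3-space $\mathbb{R}^3_1$ is $\mathbb{R}^3$ with $\langle x,y\rangle=x_1y_1+x_2y_2-x_3y_3$ and $\|x\|=\sqrt{|\langle x,x\rangle|}$. A vector $x$ is space-like if $\langle x,x\rangle>0$ or $x=0$, time-like if $\langle x,x\rangle<0$, light-like if $\langle x,x\rangle=0$ and $x\ne0$. A regular curve is space-like (time-like) if all its velocity vectors are; it is unit speed if its velocity has pseudo-norm $1$. Curves are smooth. The Lorentzian cross product $x\times y$ is the vector determined by $\langle x\times y,z\rangle=\det(x,y,z)$ for all $z$. Hyperbolic space is $\mathbb{H}^2=\{x\in\mathbb{R}^3_1:\langle x,x\rangle=-1\}$. For a unit speed space-like curve $g$ on $\mathbb{H}^2$, put $t=g'$ and $s=g\times t$; its geodesic curvature is $\kappa_g(v)=\det(g(v),t(v),t'(v))$ (the subscript in $\kappa_g$ stands for ''geodesic''). When $\kappa_g^2>1$, the hyperbolic evolute of $g$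 is $$h_g(v)=\frac{\kappa_g(v)g(v)+s(v)}{\sqrt{\kappa_g^2(v)-1}}.$$ For a time-like curve $\alpha$ (derivatives with respect to arc length) with $T'\neq0$, the Frenet frame is $T=\alpha'$, $N=\alpha''/\|\alpha''\|$, $B=T\times N$; curvature $\kappa=\|T'\|$, torsion $\tau=\langle N',B\rangle$. Its Darboux vector is $D=\tau T+\kappa B$ and, when $D$ is nowhere light-like, its hyperbolic Darboux image is $C=D/\|D\|$. Such a curve (in particular with $T'$ nowhere zero) is a (time-like) Bertrand curve if there are non-zero real constants $A,B$ with $A\kappa+B\tau=1$ everywhere. *)

(* Defs.v *)
From Stdlib Require Import Reals Lra.
From Coquelicot Require Import Coquelicot.
Open Scope R_scope.

(* The underlying space R^3 of Minkowski 3-space; [plus] and [scal] are those of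
   Coquelicot's product module. *)
Definition vec : Type := (R * R * R)%type.

Definition c1 (x : vec) : R := fst (fst x).
Definition c2 (x : vec) : R := snd (fst x).
Definition c3 (x : vec) : R := snd x.

Definition vzero : vec := (0, 0, 0).

Definition ip (x y : vec) : R := c1 x * c1 y + c2 x * c2 y - c3 x * c3 y.

Definition pnorm (x : vec) : R := sqrt (Rabs (ip x x)).

Definition space_like (x : vec) : Prop := 0 < ip x x \/ x = vzero.
Definition time_like (x : vec) : Prop := ip x x < 0.
Definition light_like (x : vec) : Prop := ip x x = 0 /\ x <> vzero.

Definition det3 (x y z : vec) : R :=
    c1 x * (c2 y * c3 z - c3 y * c2 z)
  - c2 x * (c1 y * c3 z - c3 y * c1 z)
  + c3 x * (c1 y * c2 z - c2 y * c1 z).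

(* The sign of the last entry differs from the Euclidean cross product; see
   [cross_spec] and [cross_unique]. *)
Definition cross (x y : vec) : vec :=
  (c2 x * c3 y - c3 x * c2 y,
   c3 x * c1 y - c1 x * c3 y,
   - (c1 x * c2 y - c2 x * c1 y)).

Lemma cross_spec (x y z : vec) : ip (cross x y) z = det3 x y z.
Proof. unfold ip, cross, det3, c1, c2, c3; simpl; ring. Qed.

Lemma cross_unique (x y w : vec) :
  (forall z, ip w z = det3 x y z) -> w = cross x y.
Proof.
  intros H.
  pose proof (H (1, 0, 0)) as H1; pose proof (H (0, 1, 0)) as H2;
  pose proof (H (0, 0, 1)) as H3; clear H.
  destruct x as [[x1 x2] x3], y as [[y1 y2] y3], w as [[w1 w2] w3].
  unfold ip, det3, cross, c1, c2, c3 in *; simpl in *.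
  f_equal; [f_equal|]; lra.
Qed.

Definition hyperbolic_plane (x : vec) : Prop := ip x x = -1.

Definition interval_Rbar (lo hi : Rbar) (v : R) : Prop :=
  Rbar_lt lo v /\ Rbar_lt v hi.

(* A curve on an open interval I is a total function R -> vec of which only the
   values on I matter. *)
Definition smooth_on (I : R -> Prop) (f : R -> vec) : Prop :=
  forall (n : nat) (v : R), I v ->
    ex_derive_n (fun w => c1 (f w)) n v /\
    ex_derive_n (fun w => c2 (f w)) n v /\
    ex_derive_n (fun w => c3 (f w)) n v.

Definition velocity (f : R -> vec) (v : R) : vec :=
  (Derive (fun w => c1 (f w)) v,
   Derive (fun w => c2 (f w)) v,
   Derive (fun w => c3 (f w)) v).

Definition space_like_curve (I : R -> Prop) (f : R -> vec) : Prop :=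
  smooth_on I f /\
  forall v, I v -> velocity f v <> vzero /\ space_like (velocity f v).

Definition time_like_curve (I : R -> Prop) (f : R -> vec) : Prop :=
  smooth_on I f /\
  forall v, I v -> velocity f v <> vzero /\ time_like (velocity f v).

Definition unit_speed (I : R -> Prop) (f : R -> vec) : Prop :=
  forall v, I v -> pnorm (velocity f v) = 1.

Definition sframe (g : R -> vec) (v : R) : vec := cross (g v) (velocity g v).

Definition geodesic_curvature (g : R -> vec) (v : R) : R :=
  det3 (g v) (velocity g v) (velocity (velocity g) v).

Definition hyperbolic_evolute (g : R -> vec) (v : R) : vec :=
  scal (/ sqrt (geodesic_curvature g v ^ 2 - 1))
       (plus (scal (geodesic_curvature g v) (g v)) (sframe g v)).

(* Signed arc length of [alpha] from parameter v to parameter w. *)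
Definition arc_length (alpha : R -> vec) (v w : R) : R :=
  RInt (fun x => pnorm (velocity alpha x)) v w.

(* Derivative, at the point of parameter v, of a field f along [alpha] with
   respect to the arc length of [alpha]; the parameter of [alpha] itself is
   arbitrary, so that all the quantities below are functions of that
   parameter. *)
Definition arc_derive1 (alpha : R -> vec) (f : R -> R) (v : R) : R :=
  real (Lim (fun w => (f w - f v) / arc_length alpha v w) v).

Definition arc_derive (alpha : R -> vec) (f : R -> vec) (v : R) : vec :=
  (arc_derive1 alpha (fun w => c1 (f w)) v,
   arc_derive1 alpha (fun w => c2 (f w)) v,
   arc_derive1 alpha (fun w => c3 (f w)) v).

Definition frenet_T (alpha : R -> vec) : R -> vec := arc_derive alpha alpha.

Definition frenet_T' (alpha : R -> vec) : R -> vec :=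
  arc_derive alpha (frenet_T alpha).

Definition frenet_N (alpha : R -> vec) (v : R) : vec :=
  scal (/ pnorm (frenet_T' alpha v)) (frenet_T' alpha v).

Definition frenet_B (alpha : R -> vec) (v : R) : vec :=
  cross (frenet_T alpha v) (frenet_N alpha v).

Definition curvature (alpha : R -> vec) (v : R) : R :=
  pnorm (frenet_T' alpha v).

Definition torsion (alpha : R -> vec) (v : R) : R :=
  ip (arc_derive alpha (frenet_N alpha) v) (frenet_B alpha v).

Definition darboux (alpha : R -> vec) (v : R) : vec :=
  plus (scal (torsion alpha v) (frenet_T alpha v))
       (scal (curvature alpha v) (frenet_B alpha v)).

(* Meaningful where the Darboux vector has non-zero pseudo-norm; where it is
   light-like or zero, this is a vector x with ip x x = 0. *)
Definition hyperbolic_darboux_image (alpha : R -> vec) (v : R) : vec :=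
  scal (/ pnorm (darboux alpha v)) (darboux alpha v).

Definition time_like_bertrand (I : R -> Prop) (alpha : R -> vec) : Prop :=
  time_like_curve I alpha /\
  (forall v, I v -> frenet_T' alpha v <> vzero) /\
  exists A B : R, A <> 0 /\ B <> 0 /\
    forall v, I v -> A * curvature alpha v + B * torsion alpha v = 1.

Definition coth (x : R) : R := cosh x / sinh x.

Definition vRInt (f : R -> vec) (v w : R) : vec :=
  (RInt (fun x => c1 (f x)) v w,
   RInt (fun x => c2 (f x)) v w,
   RInt (fun x => c3 (f x)) v w).

Definition bertrand_candidate (g : R -> vec) (a xi : R) (v : R) : vec :=
  plus (scal a (vRInt g 0 v))
       (scal (a * tanh xi) (vRInt (fun t => cross (g t) (velocity g t)) 0 v)).

(* Main.v *)
From Stdlib Require Import Reals Lra.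
From Coquelicot Require Import Coquelicot.
Require Import Defs.
Open Scope R_scope.

(** Write [t = g'], [s = g x t], [m = tanh xi2], and [k] for the geodesic
    curvature of [g].  The triple [g, t, s] is a pseudo-orthonormal frame and
    satisfies the hyperbolic Frenet equations [g' = t], [t' = g + k s],
    [s' = - k t]
    ([velocity_velocity_hyperbolic], [is_velocity_sframe]).  Since
    [gamma' = a (g + m s)] and [m^2 < 1], the curve [gamma] has constant speed
    [c] with [c^2 = a^2 (1 - m^2)], so that differentiating along [gamma] with
    respect to arc length is differentiating with respect to the parameter and
    dividing by [c] ([arc_derive_const_speed]).  The Frenet equations then give
    [T = (a / c) (g + m s)] and [T' = p t] with [p = (a / c^2) (1 - m k)].
    As [T'] does not vanish, the sign [e] of [p] is locally constant, whence
    [N = e t], [B = (e a / c) (s + m g)], curvature [e p] and torsion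
    [(a / c^2) (k - m)].  In the Darboux vector the sign [e] appears squared
    and the cross terms in [m] cancel:
    [D = (a^2 / c^3) ((k - m) (g + m s) + (1 - m k) (s + m g)) = (k g + s) / c].
    So [D] is a positive multiple of [k g + s]; normalizing both gives the
    theorem, as [k g + s] has scalar square [1 - k^2 < 0]. *)

(** * Algebra of the Lorentzian product *)

Lemma plus_vec (x y : vec) :
  plus x y = (c1 x + c1 y, c2 x + c2 y, c3 x + c3 y).
Proof. reflexivity. Qed.

Lemma scal_vec (r : R) (x : vec) : scal r x = (r * c1 x, r * c2 x, r * c3 x).
Proof. reflexivity. Qed.

Ltac vec_unfold :=
  rewrite ?plus_vec, ?scal_vec; unfold vzero, cross, det3, ip; cbn [c1 c2 c3 fst snd];
  unfold c1, c2, c3; cbn [fst snd].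

(** Only variables are split into coordinates: compound vectors that should
    count as atoms have to be generalized before the call. *)
Ltac vec_ring :=
  repeat match goal with x : vec |- _ => destruct x as [[? ?] ?] end;
  vec_unfold; match goal with
    | |- @eq R _ _ => ring
    | |- _ => f_equal; [f_equal|]; ring
    end.

Lemma ip_cross_cross (x y : vec) :
  ip (cross x y) (cross x y) = ip x y ^ 2 - ip x x * ip y y.
Proof. vec_ring. Qed.

Lemma cross_cross_l (x y : vec) :
  cross x (cross x y) = plus (scal (ip x x) y) (scal (- ip x y) x).
Proof. vec_ring. Qed.

Lemma cross_cross_r (x y : vec) :
  cross (cross x y) y = plus (scal (ip y y) x) (scal (- ip x y) y).
Proof. vec_ring. Qed.

(** Expansion of [z] in the frame [x, y, x x y] by inverting its Gram matrix;
    the determinant is cleared, which makes the identity polynomial. *)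
Lemma cross_frame_expansion (x y z : vec) :
  scal (ip x y ^ 2 - ip x x * ip y y) z =
  plus (plus (scal (ip x y * ip z y - ip y y * ip z x) x)
             (scal (ip x y * ip z x - ip x x * ip z y) y))
       (scal (det3 x y z) (cross x y)).
Proof. vec_ring. Qed.

Lemma ip_frame_combination (x y z w : R) (p q : vec) :
  ip (plus (scal x p) (scal y q)) (plus (scal z p) (scal w q)) =
  x * z * ip p p + (x * w + y * z) * ip p q + y * w * ip q q.
Proof. vec_ring. Qed.

Lemma ip_cross_l (x y : vec) : ip x (cross x y) = 0.
Proof. vec_ring. Qed.

Lemma ip_sym (x y : vec) : ip x y = ip y x.
Proof. vec_ring. Qed.

Lemma ip_scal (r : R) (x : vec) : ip (scal r x) (scal r x) = r ^ 2 * ip x x.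
Proof. vec_ring. Qed.

Lemma pnorm_scal (r : R) (x : vec) : pnorm (scal r x) = Rabs r * pnorm x.
Proof.
  unfold pnorm. rewrite ip_scal, Rabs_mult, sqrt_mult by apply Rabs_pos.
  f_equal. rewrite <- RPow_abs, <- Rsqr_pow2. apply sqrt_Rsqr, Rabs_pos.
Qed.

(** Makes it enough to know a vector, such as the Darboux vector, up to a
    positive factor. *)
Lemma normalize_scal (r : R) (x : vec) :
  0 < r -> scal (/ pnorm (scal r x)) (scal r x) = scal (/ pnorm x) x.
Proof.
  intros Hr.
  rewrite pnorm_scal, (Rabs_pos_eq r), Rinv_mult by lra.
  destruct x as [[x1 x2] x3]. generalize (/ pnorm (x1, x2, x3)); intros q.
  vec_unfold. f_equal; [f_equal|]; field; lra.
Qed.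

(** The pseudo-norm forgets the sign of the scalar square; the causal
    character restores it. *)
Lemma ip_unit_space_like (x : vec) :
  x <> vzero -> space_like x -> pnorm x = 1 -> ip x x = 1.
Proof.
  intros Hx [Hp | H0] H1; [|contradiction].
  unfold pnorm in H1.
  rewrite Rabs_pos_eq in H1 by lra.
  rewrite <- (sqrt_sqrt (ip x x)), H1 by lra. ring.
Qed.

(** * Real functions and intervals *)

Lemma tanh_square_lt_1 (x : R) : tanh x ^ 2 < 1.
Proof.
  pose proof (exp_pos x). pose proof (exp_pos (- x)).
  unfold tanh, sinh, cosh.
  replace (((exp x - exp (- x)) / 2 / ((exp x + exp (- x)) / 2)) ^ 2)
    with ((exp x - exp (- x)) ^ 2 / (exp x + exp (- x)) ^ 2) by (field; lra).
  apply Rmult_lt_reg_r with ((exp x + exp (- x)) ^ 2); [nra|].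
  unfold Rdiv. rewrite Rmult_assoc, Rinv_l by nra. nra.
Qed.

(** The normal of a curve with [T' = p t] and [t] unit is [p / |p|] times [t];
    this lets the factor [p / |p|] be treated as a constant in differentiation. *)
Lemma locally_same_sign (p : R -> R) (v : R) :
  continuous p v -> p v <> 0 ->
  locally v (fun w : R => / Rabs (p w) * p w = / Rabs (p v) * p v).
Proof.
  intros Hc H0.
  assert (H : locally v (fun w : R => Rabs (p w - p v) < Rabs (p v))).
  { apply (Hc (fun y => Rabs (y - p v) < Rabs (p v))).
    exists (mkposreal _ (Rabs_pos_lt _ H0)). intros y Hy. exact Hy. }
  eapply filter_imp; [|exact H]. intros w Hw; cbv beta in Hw.
  assert (sgn : forall x, x <> 0 -> / Rabs x * x = if Rlt_dec 0 x then 1 else -1).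
  { intros x Hx. destruct (Rlt_dec 0 x).
    - rewrite Rabs_pos_eq by lra. field; lra.
    - rewrite Rabs_left by lra. field; lra. }
  assert (Hpw : p w <> 0).
  { intros E. rewrite E, Rminus_0_l, Rabs_Ropp in Hw. lra. }
  rewrite !sgn by assumption. revert Hw. unfold Rabs.
  repeat destruct Rcase_abs; repeat destruct Rlt_dec; lra.
Qed.

Lemma interval_Rbar_open (lo hi : Rbar) (v : R) :
  interval_Rbar lo hi v -> locally v (interval_Rbar lo hi).
Proof.
  intros [Hl Hh].
  exact (filter_and _ _ (open_Rbar_gt' v lo Hl) (open_Rbar_lt' v hi Hh)).
Qed.

Lemma interval_Rbar_convex (lo hi : Rbar) (y z w : R) :
  interval_Rbar lo hi y -> interval_Rbar lo hi z -> y <= w <= z ->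
  interval_Rbar lo hi w.
Proof.
  intros [Hy _] [_ Hz] [H1 H2]. split.
  - apply (Rbar_lt_le_trans _ y); assumption.
  - apply (Rbar_le_lt_trans _ z); assumption.
Qed.

(** * Velocities of vector fields along a curve *)

(** A relational form of [velocity], which also records differentiability. *)
Definition is_velocity (f : R -> vec) (v : R) (l : vec) : Prop :=
  is_derive (fun w : R => c1 (f w)) v (c1 l) /\
  is_derive (fun w : R => c2 (f w)) v (c2 l) /\
  is_derive (fun w : R => c3 (f w)) v (c3 l).

Lemma is_velocity_unique (f : R -> vec) (v : R) (l : vec) :
  is_velocity f v l -> velocity f v = l.
Proof.
  destruct l as [[l1 l2] l3]. intros (H1 & H2 & H3).
  exact (f_equal2 pair
    (f_equal2 pair (is_derive_unique _ _ _ H1) (is_derive_unique _ _ _ H2))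
    (is_derive_unique _ _ _ H3)).
Qed.

Lemma is_velocity_ext_loc (f h : R -> vec) (v : R) (l : vec) :
  locally v (fun w : R => f w = h w) -> is_velocity f v l -> is_velocity h v l.
Proof.
  intros He (H1 & H2 & H3).
  split; [|split]; (eapply is_derive_ext_loc; [|eassumption]);
    (eapply filter_imp; [|exact He]); intros w ->; reflexivity.
Qed.

Lemma is_velocity_scal (r : R) (f : R -> vec) (v : R) (l : vec) :
  is_velocity f v l -> is_velocity (fun w => scal r (f w)) v (scal r l).
Proof.
  intros (H1 & H2 & H3).
  split; [|split]; apply (fun F => is_derive_scal F v r); assumption.
Qed.

Lemma is_velocity_plus (f h : R -> vec) (v : R) (l k : vec) :
  is_velocity f v l -> is_velocity h v k ->
  is_velocity (fun w => plus (f w) (h w)) v (plus l k).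
Proof.
  intros (H1 & H2 & H3) (K1 & K2 & K3).
  split; [|split]; apply @is_derive_plus; assumption.
Qed.

Lemma is_derive_Rmult (f h : R -> R) (v l k : R) :
  is_derive f v l -> is_derive h v k ->
  is_derive (fun w : R => f w * h w) v (l * h v + f v * k).
Proof.
  intros Hf Hh. apply (is_derive_mult f h v l k Hf Hh). exact Rmult_comm.
Qed.

Lemma is_derive_ip (f h : R -> vec) (v : R) (l k : vec) :
  is_velocity f v l -> is_velocity h v k ->
  is_derive (fun w : R => ip (f w) (h w)) v (ip l (h v) + ip (f v) k).
Proof.
  intros (H1 & H2 & H3) (K1 & K2 & K3).
  pose proof (@is_derive_minus _ _ _ _ _ _ _
    (@is_derive_plus _ _ _ _ _ _ _ (is_derive_Rmult _ _ _ _ _ H1 K1)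
                        (is_derive_Rmult _ _ _ _ _ H2 K2))
    (is_derive_Rmult _ _ _ _ _ H3 K3)) as H.
  cbv beta in H.
  match type of H with is_derive _ _ ?d => replace (ip l (h v) + ip (f v) k) with d end.
  - exact H.
  - unfold ip, minus, plus, opp; simpl; ring.
Qed.

Lemma is_velocity_cross (f h : R -> vec) (v : R) (l k : vec) :
  is_velocity f v l -> is_velocity h v k ->
  is_velocity (fun w => cross (f w) (h w)) v (plus (cross l (h v)) (cross (f v) k)).
Proof.
  intros (H1 & H2 & H3) (K1 & K2 & K3).
  assert (det2 : forall p q r s p' q' r' s',
    is_derive p v p' -> is_derive q v q' -> is_derive r v r' -> is_derive s v s' ->
    is_derive (fun w : R => p w * q w - r w * s w) v
      ((p' * q v - r' * s v) + (p v * q' - r v * s'))).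
  { intros p q r s p' q' r' s' Hp Hq Hr Hs.
    replace ((p' * q v - r' * s v) + (p v * q' - r v * s'))
      with ((p' * q v + p v * q') - (r' * s v + r v * s')) by ring.
    apply @is_derive_minus; apply is_derive_Rmult; assumption. }
  split; [|split].
  - exact (det2 _ _ _ _ _ _ _ _ H2 K3 H3 K2).
  - exact (det2 _ _ _ _ _ _ _ _ H3 K1 H1 K3).
  - pose proof (@is_derive_opp _ _ _ _ _ (det2 _ _ _ _ _ _ _ _ H1 K2 H2 K1)) as H.
    match type of H with is_derive _ _ ?d =>
      replace (c3 (plus (cross l (h v)) (cross (f v) k))) with d end.
    + exact H.
    + rewrite plus_vec. unfold cross, opp, c1, c2, c3; simpl. ring.
Qed.

Lemma smooth_on_is_velocity (U : R -> Prop) (f : R -> vec) (v : R) :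
  smooth_on U f -> U v -> is_velocity f v (velocity f v).
Proof.
  intros Hf Hv. destruct (Hf 1%nat v Hv) as (H1 & H2 & H3).
  split; [|split]; apply Derive_correct; assumption.
Qed.

Lemma smooth_on_velocity (U : R -> Prop) (f : R -> vec) :
  smooth_on U f -> smooth_on U (velocity f).
Proof.
  (* [ex_derive_n F 0] is trivially true, so order 0 needs its own case. *)
  assert (step : forall (F : R -> R) n v,
    ex_derive_n F (S n) v -> ex_derive_n (Derive F) n v).
  { intros F [|n] v H; [exact I|].
    apply (ex_derive_ext (Derive_n F (S n))); [|exact H].
    intros w. rewrite <- Nat.add_1_r. symmetry.
    exact (Derive_n_comp F n 1 w). }
  intros Hf n v Hv. destruct (Hf (S n) v Hv) as (H1 & H2 & H3).
  split; [|split]; apply step; assumption.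
Qed.

(** The product rule for a locally constant scalar product: this is how the
    relations of a moving frame constrain its derivatives. *)
Lemma ip_const_velocity (f h : R -> vec) (v r : R) (l k : vec) :
  locally v (fun w : R => ip (f w) (h w) = r) ->
  is_velocity f v l -> is_velocity h v k ->
  ip l (h v) + ip (f v) k = 0.
Proof.
  intros Hr Hf Hh.
  transitivity (Derive (fun w => ip (f w) (h w)) v).
  - symmetry. apply is_derive_unique, is_derive_ip; assumption.
  - transitivity (Derive (fun _ => r) v); [exact (Derive_ext_loc _ _ v Hr)|].
    apply Derive_const.
Qed.

(** Convexity keeps the integration path between [x] and [v] inside [U], the
    only place where [f] is known to be continuous. *)
Lemma is_velocity_vRInt (U : R -> Prop) (f : R -> vec) (x v : R) :
  (forall y z w, U y -> U z -> y <= w <= z -> U w) ->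
  (forall w, U w -> locally w U) ->
  (forall w, U w -> exists l, is_velocity f w l) ->
  U x -> U v -> is_velocity (vRInt f x) v (f v).
Proof.
  intros Hconv Hopen Hf Hx Hv.
  assert (comp : forall F : R -> R, (forall w, U w -> continuous F w) ->
    is_derive (fun w : R => RInt F x w) v (F v)).
  { intros F HF. apply (is_derive_RInt F _ x); [|apply HF, Hv].
    eapply filter_imp; [|exact (Hopen v Hv)]. intros w Hw.
    apply @RInt_correct, @ex_RInt_continuous. intros z Hz. apply HF.
    destruct (Rle_dec x w) as [Hxw|Hxw].
    - rewrite Rmin_left, Rmax_right in Hz by lra. exact (Hconv x w z Hx Hw Hz).
    - rewrite Rmin_right, Rmax_left in Hz by lra. exact (Hconv w x z Hw Hx Hz). }
  split; [|split]; apply (comp (fun w => _ (f w))); intros w Hw;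
    destruct (Hf w Hw) as [l (H1 & H2 & H3)]; apply @ex_derive_continuous;
    eexists; eassumption.
Qed.

(** * Arc-length derivatives along a curve of constant speed *)

Lemma arc_length_const_speed (alpha : R -> vec) (v w c : R) :
  (forall x, Rmin v w <= x <= Rmax v w -> pnorm (velocity alpha x) = c) ->
  arc_length alpha v w = c * (w - v).
Proof.
  intros H. unfold arc_length.
  rewrite (RInt_ext _ (fun _ => c)) by (intros x Hx; apply H; lra).
  rewrite RInt_const. unfold scal; simpl; unfold mult; simpl. ring.
Qed.

Lemma arc_derive1_const_speed (alpha : R -> vec) (f : R -> R) (v c l : R) :
  c <> 0 ->
  locally v (fun x : R => pnorm (velocity alpha x) = c) ->
  is_derive f v l -> arc_derive1 alpha f v = / c * l.
Proof.
  intros Hc [eps Hs] Hf. unfold arc_derive1.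
  rewrite (is_lim_unique _ v (Finite (/ c * l))); [reflexivity|].
  apply is_lim_spec. intros e.
  apply is_derive_Reals in Hf.
  assert (He : 0 < e * Rabs c).
  { apply Rmult_lt_0_compat; [apply cond_pos|apply Rabs_pos_lt, Hc]. }
  destruct (Hf _ He) as [d Hd].
  assert (Hm : 0 < Rmin eps d) by (apply Rmin_pos; apply cond_pos).
  exists (mkposreal _ Hm). intros w Hw Hwv. change R in w.
  change (Rabs (w - v) < Rmin eps d) in Hw.
  assert (Hwe : Rabs (w - v) < eps) by (eapply Rlt_le_trans; [exact Hw|apply Rmin_l]).
  assert (Hwd : Rabs (w - v) < d) by (eapply Rlt_le_trans; [exact Hw|apply Rmin_r]).
  rewrite (arc_length_const_speed alpha v w c).
  2:{ intros x Hx. apply Hs. change (Rabs (x - v) < eps).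
      revert Hx Hwe. unfold Rmin, Rmax, Rabs.
      repeat destruct Rle_dec; repeat destruct Rcase_abs; lra. }
  assert (Hh : w - v <> 0) by lra.
  specialize (Hd (w - v) Hh Hwd). replace (v + (w - v)) with w in Hd by ring.
  replace ((f w - f v) / (c * (w - v)) - / c * l)
    with (/ c * ((f w - f v) / (w - v) - l)) by (field; split; assumption).
  rewrite Rabs_mult, Rabs_inv.
  apply Rmult_lt_reg_l with (Rabs c); [apply Rabs_pos_lt, Hc|].
  rewrite <- Rmult_assoc, Rinv_r by (apply Rabs_no_R0, Hc). lra.
Qed.

(** Near the base point the arc length is the parameter difference times the
    speed, so the arc-length difference quotients are rescaled ordinary ones. *)
Lemma arc_derive_const_speed (alpha f : R -> vec) (v c : R) (l : vec) :
  c <> 0 ->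
  locally v (fun x : R => pnorm (velocity alpha x) = c) ->
  is_velocity f v l -> arc_derive alpha f v = scal (/ c) l.
Proof.
  intros Hc Hs (H1 & H2 & H3). unfold arc_derive.
  rewrite (arc_derive1_const_speed _ _ _ _ _ Hc Hs H1),
    (arc_derive1_const_speed _ _ _ _ _ Hc Hs H2),
    (arc_derive1_const_speed _ _ _ _ _ Hc Hs H3).
  reflexivity.
Qed.

(** * The moving frame of a unit speed curve on the hyperbolic plane *)

Lemma velocity_orthogonal (U : R -> Prop) (g : R -> vec) (v : R) :
  (forall w, U w -> locally w U) -> smooth_on U g ->
  (forall w, U w -> hyperbolic_plane (g w)) -> U v ->
  ip (g v) (velocity g v) = 0.
Proof.
  intros Hopen Hg Hh Hv.
  pose proof (smooth_on_is_velocity U g v Hg Hv) as Hd.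
  assert (H := ip_const_velocity g g v (-1) _ _
    (filter_imp _ _ Hh (Hopen v Hv)) Hd Hd).
  rewrite (ip_sym (velocity g v)) in H. lra.
Qed.

(** The coefficients of [g''] in the frame are read off by differentiating
    [<g, g'> = 0] and [<g', g'> = 1]; the last one is the geodesic curvature
    by definition. *)
Lemma velocity_velocity_hyperbolic (U : R -> Prop) (g : R -> vec) (v : R) :
  (forall w, U w -> locally w U) -> smooth_on U g ->
  (forall w, U w -> hyperbolic_plane (g w)) ->
  (forall w, U w -> ip (velocity g w) (velocity g w) = 1) -> U v ->
  velocity (velocity g) v = plus (g v) (scal (geodesic_curvature g v) (sframe g v)).
Proof.
  intros Hopen Hg Hh Ht Hv.
  pose proof (smooth_on_is_velocity U g v Hg Hv) as Hd.
  pose proof (smooth_on_is_velocity U _ v (smooth_on_velocity U g Hg) Hv) as Hdd.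
  pose proof (velocity_orthogonal U g v Hopen Hg Hh Hv) as Hgt.
  assert (Hgd := ip_const_velocity g (velocity g) v 0 _ _
    (filter_imp _ _ (fun w => velocity_orthogonal U g w Hopen Hg Hh) (Hopen v Hv))
    Hd Hdd).
  assert (Htd := ip_const_velocity (velocity g) (velocity g) v 1 _ _
    (filter_imp _ _ Ht (Hopen v Hv)) Hdd Hdd).
  pose proof (cross_frame_expansion (g v) (velocity g v) (velocity (velocity g) v)) as He.
  specialize (Hh v Hv). specialize (Ht v Hv). unfold hyperbolic_plane in Hh.
  rewrite Hgt, Hh, Ht in He. rewrite Ht in Hgd.
  rewrite (ip_sym (velocity g v)) in Htd.
  rewrite (ip_sym (g v)) in Hgd.
  replace (ip (velocity (velocity g) v) (velocity g v)) with 0 in He.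
  2:{ rewrite (ip_sym (velocity (velocity g) v)) in *. lra. }
  replace (ip (velocity (velocity g) v) (g v)) with (-1) in He by lra.
  unfold geodesic_curvature, sframe.
  revert He. generalize (velocity (velocity g) v) as z. intros z He.
  transitivity (scal (0 ^ 2 - -1 * 1) z); [clear; vec_ring|].
  rewrite He. clear.
  generalize (det3 (g v) (velocity g v) z), (cross (g v) (velocity g v)), (velocity g v), (g v).
  intros; vec_ring.
Qed.

(** The product rule gives [s' = t x t + g x (g + k s) = k (g x s)], and
    [g x s = g x (g x t) = - t]. *)
Lemma is_velocity_sframe (U : R -> Prop) (g : R -> vec) (v : R) :
  (forall w, U w -> locally w U) -> smooth_on U g ->
  (forall w, U w -> hyperbolic_plane (g w)) ->
  (forall w, U w -> ip (velocity g w) (velocity g w) = 1) -> U v ->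
  is_velocity (sframe g) v (scal (- geodesic_curvature g v) (velocity g v)).
Proof.
  intros Hopen Hg Hh Ht Hv.
  pose proof (smooth_on_is_velocity U g v Hg Hv) as Hd.
  pose proof (smooth_on_is_velocity U _ v (smooth_on_velocity U g Hg) Hv) as Hdd.
  pose proof (is_velocity_cross _ _ _ _ _ Hd Hdd) as H.
  rewrite (velocity_velocity_hyperbolic U g v Hopen Hg Hh Ht Hv) in H.
  replace (scal (- geodesic_curvature g v) (velocity g v)) with
    (plus (cross (velocity g v) (velocity g v))
       (cross (g v) (plus (g v) (scal (geodesic_curvature g v) (sframe g v))))).
  { exact H. }
  pose proof (cross_cross_l (g v) (velocity g v)) as Hc.
  rewrite (velocity_orthogonal U g v Hopen Hg Hh Hv), (Hh v Hv) in Hc.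
  fold (sframe g v) in Hc.
  generalize (geodesic_curvature g v). intros k.
  transitivity (scal k (cross (g v) (sframe g v))).
  { clear. generalize (sframe g v), (velocity g v), (g v). intros; vec_ring. }
  rewrite Hc. clear. generalize (velocity g v), (g v). intros; vec_ring.
Qed.

(** Needed to know that the sign of the coefficient of [T'] on [t] is locally
    constant. *)
Lemma geodesic_curvature_continuous (U : R -> Prop) (g : R -> vec) (v : R) :
  smooth_on U g -> U v -> continuous (geodesic_curvature g) v.
Proof.
  intros Hg Hv.
  pose proof (smooth_on_velocity U g Hg) as Hg1.
  pose proof (smooth_on_velocity U _ Hg1) as Hg2.
  apply (continuous_ext (fun w => ip (cross (g w) (velocity g w)) (velocity (velocity g) w))).
  { intros w. apply cross_spec. }
  apply @ex_derive_continuous. eexists.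
  apply is_derive_ip.
  - apply is_velocity_cross; eapply smooth_on_is_velocity; eassumption.
  - eapply smooth_on_is_velocity; eassumption.
Qed.

(** * The Frenet apparatus of the associated curve *)

Lemma is_velocity_bertrand_candidate (U : R -> Prop) (g : R -> vec) (a xi v : R) :
  (forall y z w, U y -> U z -> y <= w <= z -> U w) ->
  (forall w, U w -> locally w U) -> smooth_on U g -> U 0 -> U v ->
  is_velocity (bertrand_candidate g a xi) v
    (scal a (plus (g v) (scal (tanh xi) (sframe g v)))).
Proof.
  intros Hconv Hopen Hg H0 Hv.
  pose proof (smooth_on_velocity U g Hg) as Hg1.
  replace (scal a (plus (g v) (scal (tanh xi) (sframe g v)))) with
    (plus (scal a (g v)) (scal (a * tanh xi) (sframe g v))).
  2:{ generalize (g v), (sframe g v). intros; vec_ring. }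
  apply is_velocity_plus; apply is_velocity_scal.
  - apply (is_velocity_vRInt U); try assumption.
    intros w Hw. eexists. eapply smooth_on_is_velocity; eassumption.
  - apply (is_velocity_vRInt U (sframe g)); try assumption.
    intros w Hw. eexists.
    apply is_velocity_cross; eapply smooth_on_is_velocity; eassumption.
Qed.

(** The whole Frenet apparatus is expressed in the frame [g, t, s].  The
    factor [(a^2 / c^3) (1 - m^2)] left over in front of [k g + s] collapses to
    [1 / c] by the choice of [c], the speed of the curve. *)
Lemma darboux_bertrand_candidate (U : R -> Prop) (g : R -> vec) (a xi c v : R) :
  (forall y z w, U y -> U z -> y <= w <= z -> U w) ->
  (forall w, U w -> locally w U) -> smooth_on U g ->
  (forall w, U w -> hyperbolic_plane (g w)) ->
  (forall w, U w -> ip (velocity g w) (velocity g w) = 1) ->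
  U 0 -> a <> 0 -> c = sqrt (a ^ 2 * (1 - tanh xi ^ 2)) ->
  U v -> frenet_T' (bertrand_candidate g a xi) v <> vzero ->
  darboux (bertrand_candidate g a xi) v =
  scal (/ c) (plus (scal (geodesic_curvature g v) (g v)) (sframe g v)).
Proof.
  intros Hconv Hopen Hg Hh Ht H0 Ha Ec Hv.
  set (gamma := bertrand_candidate g a xi). set (m := tanh xi) in *.
  set (k := geodesic_curvature g).
  assert (Hm : m ^ 2 < 1) by apply tanh_square_lt_1.
  assert (Hrad : 0 < a ^ 2 * (1 - m ^ 2)).
  { apply Rmult_lt_0_compat; [|lra]. apply pow2_gt_0, Ha. }
  assert (Hc : 0 < c) by (rewrite Ec; apply sqrt_lt_R0, Hrad).
  assert (Hc2 : c ^ 2 = a ^ 2 * (1 - m ^ 2)).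
  { rewrite Ec, pow2_sqrt by lra. reflexivity. }
  assert (Hc0 : c <> 0) by lra.
  assert (Hgs : forall w, ip (g w) (sframe g w) = 0) by (intros w; apply ip_cross_l).
  assert (Hss : forall w, U w -> ip (sframe g w) (sframe g w) = 1).
  { intros w Hw. unfold sframe.
    rewrite ip_cross_cross, (velocity_orthogonal U g w Hopen Hg Hh Hw), (Hh w Hw), (Ht w Hw).
    ring. }
  assert (Hgamma : forall w, U w ->
    is_velocity gamma w (scal a (plus (g w) (scal m (sframe g w))))).
  { intros w Hw. exact (is_velocity_bertrand_candidate U g a xi w Hconv Hopen Hg H0 Hw). }
  assert (Hspeed : forall w, U w -> pnorm (velocity gamma w) = c).
  { intros w Hw.
    rewrite (is_velocity_unique _ _ _ (Hgamma w Hw)). unfold pnorm. rewrite ip_scal.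
    replace (plus (g w) (scal m (sframe g w))) with
      (plus (scal 1 (g w)) (scal m (sframe g w))).
    2:{ generalize (g w), (sframe g w). intros; vec_ring. }
    rewrite ip_frame_combination, Hgs, Hss, (Hh w Hw) by exact Hw.
    rewrite Ec. f_equal. rewrite <- Rabs_Ropp, Rabs_pos_eq; [ring|].
    match goal with |- 0 <= ?x => replace x with (a ^ 2 * (1 - m ^ 2)) by ring end.
    lra. }
  assert (arc : forall f w l, U w -> is_velocity f w l ->
    arc_derive gamma f w = scal (/ c) l).
  { intros f w l Hw Hl. apply arc_derive_const_speed; [exact Hc0| |exact Hl].
    exact (filter_imp _ _ Hspeed (Hopen w Hw)). }
  assert (HT : forall w, U w ->
    frenet_T gamma w = scal (a / c) (plus (g w) (scal m (sframe g w)))).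
  { intros w Hw. unfold frenet_T.
    rewrite (arc _ _ _ Hw (Hgamma w Hw)).
    generalize (plus (g w) (scal m (sframe g w))).
    intros; unfold Rdiv; vec_ring. }
  set (p := fun w => a / c ^ 2 * (1 - m * k w)).
  assert (HT' : forall w, U w -> frenet_T' gamma w = scal (p w) (velocity g w)).
  { intros w Hw. unfold frenet_T'.
    pose proof (is_velocity_scal (a / c) _ _ _
      (is_velocity_plus _ _ _ _ _ (smooth_on_is_velocity U g w Hg Hw)
        (is_velocity_scal m _ _ _ (is_velocity_sframe U g w Hopen Hg Hh Ht Hw)))) as Hd.
    rewrite (arc _ _ _ Hw (is_velocity_ext_loc _ (frenet_T gamma) _ _
      (filter_imp _ _ (fun x Hx => eq_sym (HT x Hx)) (Hopen w Hw)) Hd)).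
    unfold p. fold k. generalize (velocity g w), (k w).
    intros [[? ?] ?] ?; vec_unfold; f_equal; [f_equal|]; field; exact Hc0. }
  intros Hne.
  assert (Hp : p v <> 0).
  { intros E. apply Hne. rewrite HT', E by exact Hv.
    generalize (velocity g v). intros; vec_ring. }
  assert (Hpc : continuous p v).
  { apply (continuous_scal_r (a / c ^ 2) (fun w => 1 - m * k w)).
    apply (continuous_minus (fun _ => 1) (fun w => m * k w)).
    - apply continuous_const.
    - apply (continuous_scal_r m k).
      exact (geodesic_curvature_continuous U g v Hg Hv). }
  assert (HtN : forall w, U w -> pnorm (velocity g w) = 1).
  { intros w Hw. unfold pnorm. rewrite (Ht w Hw), Rabs_R1. apply sqrt_1. }
  assert (Hcurv : forall w, U w -> curvature gamma w = Rabs (p w)).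
  { intros w Hw. unfold curvature. rewrite HT', pnorm_scal, HtN by exact Hw. ring. }
  set (e := / Rabs (p v) * p v).
  assert (Habs : 0 < Rabs (p v)) by exact (Rabs_pos_lt _ Hp).
  assert (Hee : e * e = 1).
  { unfold e. replace (/ Rabs (p v) * p v * (/ Rabs (p v) * p v))
      with (p v * p v / (Rabs (p v) * Rabs (p v))) by (field; lra).
    rewrite <- Rabs_mult, Rabs_pos_eq by nra. field. exact Hp. }
  assert (Hep : Rabs (p v) * e = p v).
  { unfold e. field. lra. }
  assert (HN : locally v (fun w : R => scal e (velocity g w) = frenet_N gamma w)).
  { eapply filter_imp;
      [|exact (filter_and _ _ (Hopen v Hv) (locally_same_sign p v Hpc Hp))].
    intros w [Hw Hs]. unfold frenet_N. fold (curvature gamma w).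
    rewrite Hcurv, HT' by exact Hw. fold e in Hs. rewrite <- Hs.
    generalize (/ Rabs (p w)), (velocity g w). intros; vec_ring. }
  assert (HNv := locally_singleton _ _ HN). cbv beta in HNv.
  pose proof (smooth_on_is_velocity U _ v (smooth_on_velocity U g Hg) Hv) as Hdd.
  rewrite (velocity_velocity_hyperbolic U g v Hopen Hg Hh Ht Hv) in Hdd. fold k in Hdd.
  assert (HN' : arc_derive gamma (frenet_N gamma) v =
    scal (/ c) (scal e (plus (g v) (scal (k v) (sframe g v))))).
  { apply arc; [exact Hv|]. eapply is_velocity_ext_loc; [exact HN|].
    apply is_velocity_scal, Hdd. }
  (* With [Ht] and orthogonality this reads [s x t = g], which gives [B]. *)
  assert (Hst := cross_cross_r (g v) (velocity g v)).
  rewrite (Ht v Hv), (velocity_orthogonal U g v Hopen Hg Hh Hv) in Hst.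
  fold (sframe g v) in Hst.
  assert (HB : frenet_B gamma v =
    scal (a / c * e) (plus (scal m (g v)) (scal 1 (sframe g v)))).
  { unfold frenet_B. rewrite HT, <- HNv by exact Hv.
    transitivity (scal (a / c * e) (plus (cross (g v) (velocity g v))
      (scal m (cross (sframe g v) (velocity g v))))).
    { generalize (sframe g v), (velocity g v), (g v), (a / c). clear. intros; vec_ring. }
    rewrite Hst. fold (sframe g v).
    generalize (sframe g v), (velocity g v), (g v), (a / c). clear. intros; vec_ring. }
  assert (Htau : torsion gamma v = a / c ^ 2 * (k v - m)).
  { unfold torsion. rewrite HN', HB.
    transitivity (a / c ^ 2 * (e * e) *
      ip (plus (scal 1 (g v)) (scal (k v) (sframe g v)))
         (plus (scal m (g v)) (scal 1 (sframe g v)))).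
    { generalize (g v), (sframe g v), (k v). clear -Hc0.
      intros [[? ?] ?] [[? ?] ?] ?; vec_unfold; field; exact Hc0. }
    rewrite ip_frame_combination, Hgs, Hss, (Hh v Hv), Hee by exact Hv. ring. }
  unfold darboux. rewrite Htau, Hcurv, HT, HB by exact Hv.
  transitivity (plus
    (scal (a / c ^ 2 * (k v - m)) (scal (a / c) (plus (g v) (scal m (sframe g v)))))
    (scal (a / c * (Rabs (p v) * e)) (plus (scal m (g v)) (scal 1 (sframe g v))))).
  { generalize (g v), (sframe g v), (k v), (Rabs (p v)), (a / c), (a / c ^ 2). clear.
    intros; vec_ring. }
  rewrite Hep. unfold p.
  transitivity (scal (a ^ 2 * (1 - m ^ 2) / c ^ 3) (plus (scal (k v) (g v)) (sframe g v))).
  { generalize (g v), (sframe g v), (k v). clear -Hc0.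
    intros [[? ?] ?] [[? ?] ?] ?; vec_unfold; f_equal; [f_equal|]; field; exact Hc0. }
  rewrite <- Hc2. f_equal. field. exact Hc0.
Qed.

Theorem proposition5 :
  forall (lo hi : Rbar) (g : R -> vec) (a theta u : R),
    let I := interval_Rbar lo hi in
    let xi2 := coth theta * ln u in
    let gamma := bertrand_candidate g a xi2 in
    I 0 ->
    space_like_curve I g ->
    unit_speed I g ->
    (forall v, I v -> hyperbolic_plane (g v)) ->
    (forall v, I v -> geodesic_curvature g v ^ 2 > 1) ->
    a <> 0 -> theta <> 0 -> u > 0 ->
    time_like_bertrand I gamma ->
    forall v, I v -> hyperbolic_darboux_image gamma v = hyperbolic_evolute g v.
Proof.
  intros lo hi g a theta u I xi2 gamma H0 [Hg Hsp] Hunit Hh Hk Ha _ _ (_ & HT' & _) v Hv.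
  assert (Hopen : forall w, I w -> locally w I) by (intros w; apply interval_Rbar_open).
  assert (Ht : forall w, I w -> ip (velocity g w) (velocity g w) = 1).
  { intros w Hw. destruct (Hsp w Hw). apply ip_unit_space_like; auto. }
  unfold hyperbolic_darboux_image, gamma.
  rewrite (darboux_bertrand_candidate I g a xi2 _ v (interval_Rbar_convex lo hi)
    Hopen Hg Hh Ht H0 Ha eq_refl Hv (HT' v Hv)).
  rewrite normalize_scal.
  2:{ apply Rinv_0_lt_compat, sqrt_lt_R0, Rmult_lt_0_compat; [apply pow2_gt_0, Ha|].
      pose proof (tanh_square_lt_1 xi2). lra. }
  unfold hyperbolic_evolute. do 2 f_equal. unfold pnorm. f_equal.
  replace (plus (scal (geodesic_curvature g v) (g v)) (sframe g v)) with
    (plus (scal (geodesic_curvature g v) (g v)) (scal 1 (sframe g v))).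
  2:{ generalize (geodesic_curvature g v), (g v), (sframe g v). intros; vec_ring. }
  specialize (Hk v Hv).
  rewrite ip_frame_combination. unfold sframe at 1 2 3.
  rewrite ip_cross_l, ip_cross_cross, (velocity_orthogonal I g v Hopen Hg Hh Hv),
    (Ht v Hv), (Hh v Hv).
  rewrite <- Rabs_Ropp, Rabs_pos_eq by lra. ring.
Qed.
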